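(* (a) A hereditary class $\mathcal C$ of finite posets of width at most two is minimal prime if and only if $\mathcal C=\mathrm{age}(P_1)$ or $\mathcal C=\mathrm{age}(P_2)$. (b) A hereditary class $\mathcal C$ of finite graphs, each of which is the incomparability graph of a poset of width at most two, is minimal prime if and only if $\mathcal C=\mathrm{age}(H)$ or $\mathcal C=\mathrm{age}(\mathrm P_\infty)$.
   Context: A module of a structure (poset or graph) on $V$ is a set $A\subseteq V$ such that each $v\notin A$ relates identically (below/above/incomparable, resp. adjacent/nonadjacent) to all elements of $A$; it is trivial if it is $\emptyset$, a singleton or $V$; a structure is prime if all its modules are trivial. A hereditary class of finite structures (closed under embeddability as induced substructures) is minimal prime if it contains infinitely many prime members while every proper hereditary subclass contains only finitely many. The age of a structure is the class of finite structures embeddable in it. $\mathrm P_\infty$ is the one-way infinite path. $H$ is the graph on disjoint independent sets $\{a_i:i\in\mathbb N\}$, $\{b_i:i\in\mathbb N\}$ with $\{a_i,b_j\}$ an edge iff $i\le j$. Let $\le$ be the natural order on $\mathbb N$; let $\le_{\omega+\omega}$ list the odd integers in natural order before all even integers in natural order; let $\sigma$ be the permutation of $\mathbb N$ with $\sigma(0)=1$, $\sigma(1)=3$, and for $n\ge1$, $\sigma(2n)=2n-2$, $\sigma(2n+1)=2n+3$, and $i\le_\omega j$ iff $\sigma(i)\le\sigma(j)$. Then $P_1:=(\mathbb N,\le\cap\le_{\omega+\omega})$ and $P_2:=(\mathbb N,\le\cap\le_\omega)$. *)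

(* Defs.v *)
From mathcomp Require Import all_boot.

Set Implicit Arguments.
Unset Strict Implicit.
Unset Printing Implicit Defensive.

(* Posets (through their reflexive order) and graphs (through adjacency) are
   both treated as sets with one binary relation, so that embeddings, modules
   and primality are defined once for both. *)
Record finStruct := FinStruct { carrier :> finType; srel : rel carrier }.

Definition is_poset (T : Type) (le : rel T) : Prop :=
  [/\ reflexive le, antisymmetric le & transitive le].

Definition is_graph (T : Type) (adj : rel T) : Prop :=
  symmetric adj /\ irreflexive adj.

Definition antichain (T : finType) (le : rel T) (A : {set T}) : bool :=
  [forall x in A, forall y in A, le x y ==> (x == y)].

Definition width (T : finType) (le : rel T) : nat :=
  \max_(A : {set T} | antichain le A) #|A|.

Definition incomp (T : Type) (le : rel T) : rel T :=
  [rel x y | ~~ le x y && ~~ le y x].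

Definition incomp_graph_of_width_le2 (S : finStruct) : Prop :=
  exists le : rel S,
    [/\ is_poset le, width le <= 2 & @srel S =2 incomp le].

(* For a reflexive order, the two equations together say that v is below,
   above or incomparable to x and y alike; for a graph each of them says that
   v is adjacent to both or to neither. *)
Definition is_module (S : finStruct) (A : {set S}) : Prop :=
  forall v x y, v \notin A -> x \in A -> y \in A ->
    srel v x = srel v y /\ srel x v = srel y v.

Definition trivial_module (S : finStruct) (A : {set S}) : Prop :=
  [\/ A = set0, exists x, A = [set x] | A = [set: S]].

Definition prime_struct (S : finStruct) : Prop :=
  forall A : {set S}, is_module A -> trivial_module A.

Definition embeds (T U : Type) (r : rel T) (s : rel U) : Prop :=
  exists f : T -> U, injective f /\ {mono f : x y / r x y >-> s x y}.

Definition isomorphic (T U : Type) (r : rel T) (s : rel U) : Prop :=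
  exists f : T -> U, bijective f /\ {mono f : x y / r x y >-> s x y}.

Definition structClass := finStruct -> Prop.

Definition subclass (C D : structClass) : Prop := forall S, C S -> D S.

Definition same_class (C D : structClass) : Prop := forall S, C S <-> D S.

Definition hereditary (C : structClass) : Prop :=
  forall S S' : finStruct,
    embeds (@srel S) (@srel S') -> C S' -> C S.

(* Members of a class are counted up to isomorphism. *)
Definition finitely_many (C : structClass) : Prop :=
  exists (n : nat) (F : 'I_n -> finStruct),
    forall S, C S -> exists i, isomorphic (@srel S) (@srel (F i)).

Definition prime_members (C : structClass) : structClass :=
  fun S => C S /\ prime_struct S.

Definition minimal_prime (C : structClass) : Prop :=
  ~ finitely_many (prime_members C) /\
  forall D : structClass, hereditary D -> subclass D C -> ~ same_class D C ->
    finitely_many (prime_members D).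

Definition age (T : Type) (r : rel T) : structClass :=
  fun S => embeds (@srel S) r.

Definition path_inf : rel nat := [rel i j | (j == i.+1) || (i == j.+1)].

(* inl i stands for a_i and inr j for b_j. *)
Definition half_graph : rel (nat + nat) :=
  fun u v => match u, v with
    | inl i, inr j => i <= j
    | inr j, inl i => i <= j
    | _, _ => false
    end.

Definition le_omega_omega : rel nat :=
  [rel i j | if odd i == odd j then i <= j else odd i].

Definition sigma (n : nat) : nat :=
  match n with
  | 0 => 1
  | 1 => 3
  | _ => if odd n then n.+2 else n.-2
  end.

Definition le_omega : rel nat := [rel i j | sigma i <= sigma j].

Definition P1 : rel nat := [rel i j | (i <= j) && le_omega_omega i j].

Definition P2 : rel nat := [rel i j | (i <= j) && le_omega i j].

(* Main.v *)
Require Import Defs.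
From mathcomp Require Import all_boot zify.
From Stdlib Require Import Classical.

Set Implicit Arguments.
Unset Strict Implicit.
Unset Printing Implicit Defensive.

(* A poset of width at most two that is prime, or whose incomparability graph G
   is prime, has G connected and no two comparable elements with the same
   neighbours in G.  If such a poset is large, then either G has a vertex b of
   large degree or G has a long induced path.  In the first case the neighbours
   of b form a chain, and consecutive neighbours are separated by an element
   comparable to b; half of the separating elements lie on the same side of b
   and together with the chain they form a long initial segment of P1.  In the
   second case the path has only two orientations, mirror images of each other,
   and carries a long initial segment of P2.  So a hereditary class with
   infinitely many primes contains one of the two ages.  These have arbitrarily
   large primes, and they are incomparable: the half graph has vertices of
   degree 3 and no two independent edges.  Minimality follows since a proper
   hereditary subclass of one age misses a segment of both structures. *)

(** * Ages and minimality *)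

Definition restr (r : rel nat) (n : nat) : finStruct :=
  @FinStruct 'I_n (fun i j => r i j).

Lemma embeds_trans (T U V : Type) (r : rel T) (s : rel U) (t : rel V) :
  embeds r s -> embeds s t -> embeds r t.
Proof.
move=> [f [fI fM]] [g [gI gM]]; exists (g \o f); split; first exact: inj_comp.
by move=> x y /=; rewrite gM fM.
Qed.

Lemma embeds_incomp (T U : Type) (r : rel T) (s : rel U) :
  embeds r s -> embeds (incomp r) (incomp s).
Proof. by move=> [f [fI fM]]; exists f; split=> // x y; rewrite /incomp /= !fM. Qed.

Lemma eq_embeds_r (T U : Type) (r : rel T) (s s' : rel U) :
  s =2 s' -> embeds r s -> embeds r s'.
Proof. by move=> e [f [fI fM]]; exists f; split=> // x y; rewrite -e. Qed.

Lemma embeds_restr_leq (r : rel nat) m n :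
  m <= n -> embeds (@srel (restr r m)) (@srel (restr r n)).
Proof.
move=> le_mn; exists (widen_ord le_mn); split=> // i j /(congr1 val) /= ij.
exact: val_inj.
Qed.

Lemma restr_age (r : rel nat) n : age r (restr r n).
Proof. by exists val; split=> //; apply: val_inj. Qed.

(** A finite subset of [nat] is bounded, so an age is exhausted by initial segments; membership
    questions reduce to the structures [restr r n]. *)
Lemma age_restrP (r : rel nat) S :
  age r S <-> exists n, embeds (@srel S) (@srel (restr r n)).
Proof.
split=> [[f [fI fM]]|[n emb]]; last exact: embeds_trans emb (restr_age r n).
have lt_f x : f x < (\max_(y : S) f y).+1 by rewrite ltnS leq_bigmax.
exists (\max_(y : S) f y).+1, (fun x => Ordinal (lt_f x)).
by split=> // x y [] /fI.
Qed.

Lemma age_hereditary (T : Type) (r : rel T) : hereditary (age r).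
Proof. by move=> S S'; apply: embeds_trans. Qed.

Lemma same_class_age (T U : Type) (r : rel T) (s : rel U) :
  embeds r s -> embeds s r -> same_class (age r) (age s).
Proof. by move=> rs sr S; split=> SP; [apply: embeds_trans rs|apply: embeds_trans sr]. Qed.

Lemma finitely_many_bounded (C : structClass) N :
  (forall S, C S -> #|S| <= N) -> finitely_many C.
Proof.
move=> leC.
(* A code is a size together with a set of pairs of ranks, all ranks being read in the single type
   ['I_N.+1]. *)
pose I := ('I_N.+1 * {set 'I_N.+1 * 'I_N.+1})%type.
pose F (u : I) := restr (fun i j => (inord i, inord j) \in u.2) u.1.
exists #|{: I}|, (fun i => F (enum_val i)) => S /leC leS.
have ltS : #|S| < N.+1 by [].
pose X := [set (inord (enum_rank p.1) : 'I_N.+1, inord (enum_rank p.2) : 'I_N.+1)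
            | p in [pred p : S * S | srel p.1 p.2]].
exists (enum_rank (Ordinal ltS, X)); rewrite enum_rankK.
exists (@enum_rank S); split; first by exists enum_val; [apply: enum_rankK|apply: enum_valK].
have rkI : injective (fun x : S => inord (enum_rank x) : 'I_N.+1).
  have lt_rk (x : S) : enum_rank x < N.+1 by exact: leq_trans (ltn_ord (enum_rank x)) (leqW leS).
  move=> x y /(congr1 val) /=; rewrite (inordK (lt_rk x)) (inordK (lt_rk y)).
  by move/val_inj/enum_rank_inj.
move=> x y /=; apply/imsetP/idP => [[[x' y']]|sxy]; last by exists (x, y).
by rewrite inE /= => s' [/rkI -> /rkI ->].
Qed.

Lemma infinitely_many_unbounded (C : structClass) :
  (forall n, exists2 S, C S & n < #|S|) -> ~ finitely_many C.
Proof.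
move=> ub [n [F FP]].
have [S CS ltS] := ub (\max_(i < n) #|F i|).
have [i [f [fB _]]] := FP S CS; move: ltS.
by rewrite (bij_eq_card fB) ltnNge leq_bigmax.
Qed.

Section MinimalPrime.

(** [Pt] is the ambient class: posets of width at most two in part (a), their incomparability graphs
    in part (b). *)
Variable Pt : structClass.

Definition unavoidable (r1 r2 : rel nat) := forall n, exists N, forall S, Pt S ->
  prime_struct S -> N < #|S| ->
  embeds (@srel (restr r1 n)) (@srel S) \/ embeds (@srel (restr r2 n)) (@srel S).

Definition many_primes (r : rel nat) :=
  forall n, exists2 m, n < m & prime_struct (restr r m).

Definition not_in_age (r s : rel nat) := exists n, ~ age s (restr r n).

Lemma many_primes_age (r : rel nat) :
  many_primes r -> ~ finitely_many (prime_members (age r)).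
Proof.
move=> rP; apply: infinitely_many_unbounded => n.
have [m ltnm mP] := rP n; exists (restr r m); last by rewrite card_ord.
by split=> //; apply: restr_age.
Qed.

(** Segments are nested, so at the larger of the two indices both segments are missed, and
    unavoidability bounds the size of the primes. *)
Lemma avoiding_finitely_many (r1 r2 : rel nat) (C : structClass) :
  unavoidable r1 r2 -> hereditary C -> subclass C Pt ->
  (exists n, ~ C (restr r1 n)) -> (exists n, ~ C (restr r2 n)) ->
  finitely_many (prime_members C).
Proof.
move=> una herC CP [n1 n1P] [n2 n2P].
have [N NP] := una (maxn n1 n2).
apply: (@finitely_many_bounded _ N) => S [CS Sprime].
rewrite leqNgt; apply/negP => /(NP S (CP S CS) Sprime).
case=> emb; [apply: n1P|apply: n2P].
  by apply: herC CS; apply: embeds_trans emb; apply/embeds_restr_leq/leq_maxl.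
by apply: herC CS; apply: embeds_trans emb; apply/embeds_restr_leq/leq_maxr.
Qed.

Lemma age_sub (r : rel nat) (C : structClass) :
  hereditary C -> (forall n, C (restr r n)) -> subclass (age r) C.
Proof. by move=> herC Cr S /age_restrP[n emb]; apply: herC emb _. Qed.

Lemma minimal_prime_age (r1 r2 : rel nat) (C : structClass) :
  unavoidable r1 r2 -> many_primes r1 -> not_in_age r2 r1 ->
  subclass C Pt -> same_class C (age r1) -> minimal_prime C.
Proof.
move=> una r1P [n2 n2P] CP Cage; split.
  move=> [n [F FP]]; apply: (many_primes_age r1P); exists n, F => S [aS Sp].
  by apply: FP; split=> //; apply/Cage.
move=> D herD DC DneC; apply: (avoiding_finitely_many una) => //.
- by move=> S /DC; apply: CP.
- apply: NNPP => allD; apply: DneC => S; split; first exact: DC.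
  move=> /Cage; apply: age_sub => // n.
  by apply: NNPP => nD; apply: allD; exists n.
- by exists n2 => /DC /Cage.
Qed.

(** A minimal prime class cannot miss a segment of each structure. If it has all segments of one, it
    includes that age, which has infinitely many primes, and minimality forces equality. *)
Lemma minimal_prime_iff (r1 r2 : rel nat) (C : structClass) :
  unavoidable r1 r2 -> many_primes r1 -> many_primes r2 ->
  not_in_age r1 r2 -> not_in_age r2 r1 ->
  hereditary C -> subclass C Pt ->
  minimal_prime C <-> same_class C (age r1) \/ same_class C (age r2).
Proof.
move=> una r1P r2P r12 r21 herC CP.
have una' : unavoidable r2 r1.
  move=> n; have [N NP] := una n; exists N => S PS Sp /(NP S PS Sp) [] ?; by [right|left].
split=> [[Cinf Cmin]|[]]; [|exact: minimal_prime_age una _ _ _|exact: minimal_prime_age una' _ _ _].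
have same r : many_primes r -> (forall n, C (restr r n)) -> same_class C (age r).
  move=> rP Cr; apply: NNPP => ne; apply: (many_primes_age rP).
  apply: Cmin; [exact: age_hereditary|exact: age_sub|].
  by move=> e; apply: ne => S; split=> /e.
apply: NNPP => ne; apply: Cinf; apply: (avoiding_finitely_many una) => //.
- apply: NNPP => all1; apply: ne; left; apply: same => // n.
  by apply: NNPP => nC; apply: all1; exists n.
- apply: NNPP => all2; apply: ne; right; apply: same => // n.
  by apply: NNPP => nC; apply: all2; exists n.
Qed.

End MinimalPrime.

(** * The two limit structures *)

(* [P2] listed along the path formed by its incomparability graph. *)
Definition path_order : rel nat := [rel i j | (i == j) || (i.+1 < j)].

(** The incomparability graph of [P2] is the path 0, 2, 1, 4, 3, 6, 5, and so on; 0 is fixed because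
    [0.-1] is 0. *)
Definition path_pos (n : nat) : nat := if odd n then n.+1 else n.-1.

Lemma path_posK : involutive path_pos.
Proof. by move=> n; rewrite /path_pos; case: ifP; case: ifP; lia. Qed.

Lemma path_pos_mono : {mono path_pos : i j / P2 i j >-> path_order i j}.
Proof.
move=> i j; rewrite /P2 /path_order /le_omega /path_pos /=.
have sE n : sigma n = if odd n then n.+2 else if n == 0 then 1 else n.-2.
  by case: n => [|[|n]].
by rewrite !sE; do ![case: ifP]; lia.
Qed.

Lemma age_P2 : same_class (age P2) (age path_order).
Proof.
apply: same_class_age.
  by exists path_pos; split; [exact: inv_inj path_posK|exact: path_pos_mono].
exists path_pos; split; first exact: inv_inj path_posK.
by move=> i j; rewrite -path_pos_mono !path_posK.
Qed.

Lemma path_orderE : incomp path_order =2 path_inf.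
Proof. by move=> i j; rewrite /incomp /path_order /path_inf /=; lia. Qed.

Lemma age_path_inf : same_class (age path_inf) (age (incomp path_order)).
Proof.
by apply: same_class_age; exists id; split=> // i j; rewrite path_orderE.
Qed.

Lemma P1E i j : P1 i j = (i <= j) && (odd j ==> odd i).
Proof. by rewrite /P1 /le_omega_omega /=; case: (odd i) (odd j) => [] [] /=; lia. Qed.

Lemma P1_incompE i j :
  incomp P1 i j = (i < j) && ~~ odd i && odd j || (j < i) && ~~ odd j && odd i.
Proof.
rewrite /incomp /= !P1E; case: (ltngtP i j) => [||->]; last by case: (odd j).
  by case: (odd i) (odd j) => [] [].
by case: (odd i) (odd j) => [] [].
Qed.

(** The vertex a_i becomes 2i and b_j becomes 2j+1, since i <= j iff 2i < 2j+1. *)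
Lemma age_half_graph : same_class (age half_graph) (age (incomp P1)).
Proof.
apply: same_class_age.
  exists (fun u => match u with inl i => i.*2 | inr j => j.*2.+1 end); split.
    by move=> [i|i] [j|j] /= e; first [lia | have -> : i = j by lia].
  by move=> [i|i] [j|j]; rewrite P1_incompE /=; lia.
exists (fun n => if odd n then inr n./2 else inl n./2); split.
  by move=> i j /=; case: ifP => oi; case: ifP => oj // [] e; lia.
by move=> i j; rewrite P1_incompE; case: ifP => oi; case: ifP => oj /=; lia.
Qed.

(** * Primality of the initial segments *)

Lemma prime_incomp (T : finType) (le : rel T) :
  prime_struct (FinStruct (incomp le)) -> prime_struct (FinStruct le).
Proof.
move=> pG A modA; apply: pG => v x y vA xA yA.
by rewrite /= /incomp /=; have [/= -> ->] := modA v x y vA xA yA.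
Qed.

Lemma module_trivialP (S : finStruct) :
  (forall A : {set S}, is_module A ->
     forall x y, x \in A -> y \in A -> x != y -> A = setT) ->
  prime_struct S.
Proof.
move=> H A modA; case: (set_0Vmem A) => [->|[x xA]]; first by constructor 1.
case: (boolP [exists y in A, x != y]) => [/existsP[y /andP[yA xy]]|].
  by constructor 3; apply: H xA yA xy.
rewrite negb_exists => /forallP all1; constructor 2; exists x.
apply/setP => y; rewrite inE; apply/idP/eqP => [yA|-> //].
by move: (all1 y); rewrite yA /= negbK => /eqP.
Qed.

(** A vertex that tells two elements of a module apart belongs to the module ([split]). Two
    consecutive vertices thus absorb the whole path in both directions, and any two vertices yield
    two consecutive ones. *)
Lemma prime_restr_incomp_path_order n :
  3 < n -> prime_struct (restr (incomp path_order) n).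
Proof.
move=> n_gt3; apply: module_trivialP => A modA x y xA yA xy.
pose B i := [exists u : 'I_n, (u == i :> nat) && (u \in A)].
have BP (u : 'I_n) : B u -> u \in A.
  by case/existsP=> v /andP[/eqP/val_inj ->].
have split k i j : k < n -> B i -> B j -> path_inf k i != path_inf k j -> B k.
  move=> kn /existsP[u /andP[/eqP ui uA]] /existsP[v /andP[/eqP vj vA]] kij.
  apply/existsP; exists (Ordinal kn); rewrite eqxx /=; apply/negPn/negP=> kA.
  have [+ _] := modA _ _ _ kA uA vA.
  by rewrite /= !path_orderE ui vj; apply/eqP.
have step i : B i -> B i.+1 -> forall k, k < n -> B k.
  move=> Bi BSi.
  have up m : i.+1 + m < n -> B (i + m) && B (i.+1 + m).
    elim: m => [|m IH] lt; first by rewrite !addn0 Bi BSi.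
    have /IH/andP[B1 B2] : i.+1 + m < n by lia.
    have -> : i + m.+1 = i.+1 + m by lia.
    rewrite B2 /=; apply: (split _ (i + m) (i.+1 + m)) => //; rewrite /path_inf /=; lia.
  have BSin : i.+1 < n.
    by case/existsP: BSi => u /andP[/eqP <- _].
  have down m : m <= i -> B (i - m) && B (i.+1 - m).
    elim: m => [|m IH] lt; first by rewrite !subn0 Bi BSi.
    have /IH/andP[B1 B2] : m <= i by lia.
    have -> : i.+1 - m.+1 = i - m by lia.
    rewrite B1 andbT; apply: (split _ (i - m) (i.+1 - m)) => //; rewrite /path_inf /=; lia.
  move=> k kn; case: (leqP k i) => ki.
    by have := down (i - k); rewrite leq_subr subKn // => /(_ isT)/andP[].
  by have := up (k - i.+1); rewrite subnKC // => /(_ kn)/andP[].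
suff [i Bi BSi] : exists2 i, B i & B i.+1.
  by apply/setP => u; rewrite inE; apply: BP; apply: step BSi _ _.
have {xA yA xy} [i [j [ij jn Bi Bj]]] : exists i j, [/\ i < j, j < n, B i & B j].
  have Bx : B x by apply/existsP; exists x; rewrite eqxx.
  have By : B y by apply/existsP; exists y; rewrite eqxx.
  case: (ltngtP x y) xy => [lt _|lt _|/val_inj->]; last by rewrite eqxx.
    by exists x, y.
  by exists y, x.
case: (ltngtP j i.+2) => [j1|j3|j2].
- by exists i => //; have -> : i.+1 = j by lia.
- by exists i => //; apply: (split _ i j) => //; rewrite /path_inf /=; lia.
(* At distance two the middle vertex is adjacent to both, so an outer neighbour is used: 3 when [i]
   is 0, which exists as [n > 3], and [i.-1] otherwise. *)
case: (posnP i) => [i0|i_gt0].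
  exists j => //; apply: (split _ i j) => //; rewrite /path_inf /=; lia.
exists i.-1; last by rewrite prednK.
by apply: (split _ i j) => //; rewrite /path_inf /=; lia.
Qed.

(** The vertex 0 is adjacent to all odd vertices and the last one to all even vertices. A module
    with elements of both parities absorbs these two, and they tell apart every other vertex; two
    elements of equal parity absorb one of the other parity. *)
Lemma prime_restr_incomp_P1 n : prime_struct (restr (incomp P1) n.*2).
Proof.
apply: module_trivialP => A modA x y xA yA xy.
pose B i := [exists u : 'I_n.*2, (u == i :> nat) && (u \in A)].
have BP (u : 'I_n.*2) : B u -> u \in A.
  by case/existsP=> v /andP[/eqP/val_inj ->].
have Bn i : B i -> i < n.*2 by case/existsP=> u /andP[/eqP <- _].
have split k i j : k < n.*2 -> B i -> B j ->
    incomp P1 k i != incomp P1 k j -> B k.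
  move=> kn /existsP[u /andP[/eqP ui uA]] /existsP[v /andP[/eqP vj vA]] kij.
  apply/existsP; exists (Ordinal kn); rewrite eqxx /=; apply/negPn/negP=> kA.
  have [+ _] := modA _ _ _ kA uA vA.
  by rewrite /= ui vj; apply/eqP.
suff [i [j [Bi Bj oi oj]]] : exists i j, [/\ B i, B j, ~~ odd i & odd j].
  have in_ := Bn i Bi; have jn := Bn j Bj.
  have B0 : B 0 by apply: (split _ i j) => //; rewrite ?P1_incompE; lia.
  have B1 : B n.*2.-1 by apply: (split _ i j) => //; rewrite ?P1_incompE; lia.
  apply/setP => u; rewrite inE; apply: BP; have un := ltn_ord u.
  case: (posnP u) => [-> //|u0].
  case: (u =P n.*2.-1 :> nat) => [-> //|u1].
  by apply: (split _ 0 n.*2.-1) => //; rewrite !P1_incompE; lia.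
have {xA yA xy} [i [j [ij jn Bi Bj]]] :
    exists i j, [/\ i < j, j < n.*2, B i & B j].
  have Bx : B x by apply/existsP; exists x; rewrite eqxx.
  have By : B y by apply/existsP; exists y; rewrite eqxx.
  case: (ltngtP x y) xy => [lt _|lt _|/val_inj->]; last by rewrite eqxx.
    by exists x, y.
  by exists y, x.
have in_ := Bn i Bi.
case: (boolP (odd i)) (boolP (odd j)) => oi [] oj.
- exists i.+1, i; split=> //; last by lia.
  by apply: (split _ i j) => //; rewrite ?P1_incompE; lia.
- by exists j, i.
- by exists i, j.
- exists i, i.+1; split=> //.
  by apply: (split _ i j) => //; rewrite ?P1_incompE; lia.
Qed.

Lemma many_primes_path_order : many_primes (incomp path_order).
Proof.
move=> n; exists (n + 4); first by lia.
by apply: prime_restr_incomp_path_order; lia.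
Qed.

Lemma many_primes_P1 : many_primes (incomp P1).
Proof.
move=> n; exists n.+1.*2; first by lia.
exact: prime_restr_incomp_P1.
Qed.

Lemma many_primes_incomp (r : rel nat) :
  many_primes (incomp r) -> many_primes r.
Proof.
move=> rP n; have [m nm mP] := rP n; exists m => //.
exact: (@prime_incomp _ (@srel (restr r m))).
Qed.

(** * Neither age contains the other *)

Lemma not_in_age_incomp (r s : rel nat) :
  not_in_age (incomp r) (incomp s) -> not_in_age r s.
Proof. by move=> [n nP]; exists n => /embeds_incomp. Qed.

(* In the incomparability graph of [P1] the vertex 0 has degree 3. *)
Lemma P1_not_in_path_order : not_in_age (incomp P1) (incomp path_order).
Proof.
exists 6 => -[f [fI fM]].
pose o k : 'I_6 := inord k.
have oK k : k < 6 -> o k = k :> nat by move=> ?; rewrite inordK.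
have e a b : a < 6 -> b < 6 -> path_inf (f (o a)) (f (o b)) = incomp P1 a b.
  by move=> la lb; rewrite -path_orderE fM /= !oK.
have := e 0 1 isT isT; have := e 0 3 isT isT; have := e 0 5 isT isT.
have ne a b : a < 6 -> b < 6 -> a != b -> f (o a) != f (o b).
  by move=> la lb; apply: contraNneq => /fI /(congr1 val) /=; rewrite !oK // => ->.
have := ne 1 3 isT isT isT; have := ne 1 5 isT isT isT; have := ne 3 5 isT isT isT.
rewrite !P1_incompE /path_inf /=; lia.
Qed.

(* The path on five vertices contains two independent edges, the half graph
   does not. *)
Lemma path_order_not_in_P1 : not_in_age (incomp path_order) (incomp P1).
Proof.
exists 5 => -[f [fI fM]].
pose o k : 'I_5 := inord k.
have oK k : k < 5 -> o k = k :> nat by move=> ?; rewrite inordK.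
have e a b : a < 5 -> b < 5 -> incomp P1 (f (o a)) (f (o b)) = path_inf a b.
  by move=> la lb; rewrite -path_orderE fM /= !oK.
have := e 0 1 isT isT; have := e 3 4 isT isT.
have := e 0 3 isT isT; have := e 0 4 isT isT.
have := e 1 3 isT isT; have := e 1 4 isT isT.
rewrite !P1_incompE /path_inf /=.
by case: (odd (f (o 0))); case: (odd (f (o 1))); case: (odd (f (o 3)));
   case: (odd (f (o 4))); rewrite ?andbT ?andbF ?orbF /=; lia.
Qed.

(** * Orders carrying a half graph or a path *)

Definition dual (T : Type) (le : rel T) : rel T := fun x y => le y x.

Lemma dual_poset (T : Type) (le : rel T) : is_poset le -> is_poset (dual le).
Proof.
move=> [r a t]; split; first exact: r.
  by move=> x y; rewrite andbC; apply: a.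
by move=> y x z xy yz; apply: t yz xy.
Qed.

Lemma incomp_dual (T : Type) (le : rel T) : incomp (dual le) =2 incomp le.
Proof. by move=> x y; rewrite /incomp /= andbC. Qed.

Lemma incomp_sym (T : Type) (le : rel T) : symmetric (incomp le).
Proof. by move=> x y; rewrite /incomp /= andbC. Qed.

Lemma incompN (T : Type) (le : rel T) x y :
  ~~ incomp le x y = le x y || le y x.
Proof. by rewrite /incomp /= negb_and !negbK. Qed.

Lemma embeds_mono (T U : Type) (r : rel T) (s : rel U) (f : T -> U) :
  reflexive s -> antisymmetric r -> {mono f : x y / r x y >-> s x y} ->
  embeds r s.
Proof.
move=> sR rA fM; exists f; split=> // x y fxy; apply: rA.
by rewrite -!fM fxy sR.
Qed.

Definition no_antichain3 (T : Type) (le : rel T) := forall x y z,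
  incomp le x y -> incomp le y z -> incomp le x z -> False.

Lemma width2_no_antichain3 (T : finType) (le : rel T) :
  reflexive le -> width le <= 2 -> no_antichain3 le.
Proof.
move=> leR w2 x y z xy yz xz.
have ne u v : incomp le u v -> u != v.
  by apply: contraTneq => ->; rewrite /incomp /= leR.
have anti : antichain le [set x; y; z].
  have inc u v : incomp le u v -> (le u v = false) * (le v u = false).
    by case/andP => /negbTE-> /negbTE->.
  apply/forallP=> u; apply/implyP; rewrite !inE => uP.
  apply/forallP=> v; apply/implyP; rewrite !inE => vP; apply/implyP.
  by case/orP: uP => [/orP[]|] /eqP->; case/orP: vP => [/orP[]|] /eqP->;
     rewrite ?eqxx ?(inc _ _ xy) ?(inc _ _ yz) ?(inc _ _ xz).
have : #|[set x; y; z]| <= 2.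
  by apply: leq_trans w2; apply: (@leq_bigmax_cond _ _ (fun A : {set T} => #|A|)).
rewrite -setUA cardsU1 cards2 !inE negb_or !ne // .
Qed.

Section Poset.

Variables (T : finType) (le : rel T).
Hypotheses (leP : is_poset le) (w2 : no_antichain3 le).

Let leR : reflexive le. Proof. by case: leP. Qed.
Let leA : antisymmetric le. Proof. by case: leP. Qed.
Let leT : transitive le. Proof. by case: leP. Qed.

(* The [v i] are neighbours of [b] in the incomparability graph, hence a chain,
   and [w i] separates the smaller neighbour [u i] from [v i] on the side above
   [b]; the [v i] and [w i] then play the odd and the even integers of [P1]. *)
Lemma half_right n (b : T) (u v w : nat -> T) :
  (forall j, j < n -> [/\ incomp le b (v j), le b (w j), incomp le (w j) (v j),
                          le (u j) (w j) & le (u j) (v j)]) ->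
  (forall i j, i < j -> j < n -> le (v i) (u j)) ->
  embeds (@srel (restr P1 n.*2)) le.
Proof.
move=> H vu.
have vv i j : i < j -> j < n -> le (v i) (v j).
  by move=> ij jn; have [_ _ _ _ ?] := H j jn; apply: leT (vu _ _ ij jn) _.
have vv' i j : i <= j -> j < n -> le (v i) (v j).
  by rewrite leq_eqVlt => /predU1P[->|]; [rewrite leR|apply: vv].
have vw i j : i < j -> j < n -> le (v i) (w j).
  by move=> ij jn; have [_ _ _ ? _] := H j jn; apply: leT (vu _ _ ij jn) _.
have vwE i j : i < n -> j < n -> le (v i) (w j) = (i < j).
  move=> i_n jn; case: ltnP => [/vw->//|ji]; apply: contraTF isT => viw.
  by have [_ _ /andP[_ /negP] + _ _] := H j jn; case; apply: leT viw; apply: vv'.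
have wvE i j : i < n -> j < n -> le (w j) (v i) = false.
  move=> i_n jn; apply: contraTF isT => wvi.
  have [_ bw _ _ _] := H j jn; have [/andP[/negP + _] _ _ _ _] := H i i_n.
  by case; apply: leT wvi.
have ww i j : i < j -> j < n -> le (w i) (w j) && ~~ le (w j) (w i).
  move=> ij jn; have i_n := ltn_trans ij jn.
  have nji : ~~ le (w j) (w i).
    apply/negP => wji; have := vwE i i i_n i_n; rewrite ltnn.
    by rewrite (leT (vw _ _ ij jn) wji).
  (* Otherwise [w i], [w j] and [v j] form an antichain of three elements. *)
  rewrite nji andbT; apply: contraT => nij; exfalso.
  apply: (w2 (x := w i) (y := w j) (z := v j)); rewrite /incomp /=.
  - by rewrite nij nji.
  - by rewrite wvE ?vwE ?ltnn.
  - by rewrite wvE ?vwE // -leqNgt ltnW.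
pose f (k : 'I_n.*2) := if odd k then v k./2 else w k./2.
apply: (@embeds_mono _ _ _ _ f) => //.
  by move=> i j; rewrite /= !P1E => H1; apply: val_inj => /=; lia.
move=> i j; rewrite /f /= P1E.
have i2 : i./2 < n by have := ltn_ord i; lia.
have j2 : j./2 < n by have := ltn_ord j; lia.
case: ifP => oi; case: ifP => oj; rewrite ?vwE ?wvE //; try lia.
- case: (ltngtP i./2 j./2) => ij.
  + by rewrite vv //; lia.
  + transitivity false; last by lia.
    apply: contraTF isT => vij; have := vwE _ _ i2 i2; rewrite ltnn.
    by rewrite (leT vij) ?vw.
  + by rewrite ij leR; lia.
- case: (ltngtP i./2 j./2) => ij.
  + by case/andP: (ww _ _ ij j2) => -> _; lia.
  + by case/andP: (ww _ _ ij i2) => _ /negbTE->; lia.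
  + by rewrite ij leR; lia.
Qed.

(** If [p i] were below [p j] and above [p j.+1], transitivity would make these consecutive vertices
    comparable; so one pair orients all pairs starting at [p i]. *)
Lemma path_orient n (p : nat -> T) i :
  (forall i j, i < n -> j < n -> incomp le (p i) (p j) = path_inf i j) ->
  i.+2 < n -> le (p i) (p i.+2) ->
  forall j, i.+1 < j -> j < n -> le (p i) (p j).
Proof.
move=> pP i2 leii; elim=> // j IH ij jn.
case: (i.+1 =P j) => [<-//|/eqP ne].
have {}IH : le (p i) (p j) by apply: IH; lia.
have /orP[//|ji] : le (p i) (p j.+1) || le (p j.+1) (p i) by rewrite -incompN pP /path_inf /=; lia.
have : incomp le (p j) (p j.+1) by rewrite pP /path_inf /=; lia.
by case/andP => _ /negP[]; apply: leT ji IH.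
Qed.

(* The complement of a path has only two transitive orientations. *)
Lemma path_orient_all n (p : nat -> T) :
  (forall i j, i < n -> j < n -> incomp le (p i) (p j) = path_inf i j) ->
  (2 < n -> le (p 0) (p 2)) ->
  forall i j, i.+1 < j -> j < n -> le (p i) (p j).
Proof.
move=> pP p02; elim=> [|i IH] j ij jn.
  by apply: (path_orient pP) => //; [lia|apply: p02; lia].
apply: (path_orient pP) => //; first by lia.
(* The orientation passes from [p i] to [p i.+1] through [p i.+3], which is above [p i]. *)
have /orP[//|ji] : le (p i.+1) (p i.+3) || le (p i.+3) (p i.+1)
  by rewrite -incompN pP /path_inf /=; lia.
have : incomp le (p i) (p i.+1) by rewrite pP /path_inf /=; lia.
case/andP => /negP[]; apply: leT ji; apply: IH; lia.
Qed.

(* With three vertices the two ends of the path could coincide. *)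
Lemma path_embeds n (p : nat -> T) :
  3 < n ->
  (forall i j, i < n -> j < n -> incomp le (p i) (p j) = path_inf i j) ->
  (forall i j, i.+1 < j -> j < n -> le (p i) (p j)) ->
  embeds (@srel (restr path_order n)) le.
Proof.
move=> n3 pP ple; apply: (@embeds_mono _ _ _ _ (fun i : 'I_n => p i)) => //.
  by move=> i j; rewrite /= /path_order /= => H; apply: val_inj => /=; lia.
have lt i j : i.+1 < j -> j < n -> le (p i) (p j) && ~~ le (p j) (p i).
  move=> ij jn; rewrite ple //=; apply/negP => ji.
  (* Equal values would give [i] and [j] the same neighbours on the path; one of [i.+1], [i.+3],
     [i.-1] refutes this. *)
  have pij : p i = p j by apply: leA; rewrite ple.
  have same k : k < n -> path_inf i k = path_inf j k.
    by move=> kn; rewrite -!pP // ?pij //; lia.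
  case: (j =P i.+2) => [j2|ne].
    case: (ltnP i.+3 n) => i3; first by have := same i.+3 i3; rewrite /path_inf /=; lia.
    by have := same i.-1; rewrite /path_inf /=; lia.
  by have := same i.+1; rewrite /path_inf /=; lia.
have inc i j : path_inf i j -> i < n -> j < n -> le (p i) (p j) = false.
  by move=> ij i_n jn; move: ij; rewrite -pP // => /andP[/negbTE].
move=> i j /=; have := ltn_ord i; have := ltn_ord j.
move: (nat_of_ord i) (nat_of_ord j) => {}i {}j jn i_n; rewrite /path_order /=.
case: (ltngtP i j) => ij.
- case: (i.+1 =P j) => [e|ne].
    by rewrite inc /path_inf /=; lia.
  have /andP[-> _] : le (p i) (p j) && ~~ le (p j) (p i) by apply: lt; lia.
  by lia.
- case: (j.+1 =P i) => [e|ne].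
    by rewrite inc /path_inf /=; lia.
  have /andP[_ /negbTE->] : le (p j) (p i) && ~~ le (p i) (p j) by apply: lt; lia.
  by lia.
- by rewrite ij leR; lia.
Qed.

End Poset.

(** This is [half_right] for the dual order with the triples listed backwards. The segment of [P1]
    of length [n.*2] is self-dual under reversal, which exchanges the parities. *)
Lemma half_left (T : finType) (le : rel T) n (b : T) (u v w : nat -> T) :
  is_poset le -> no_antichain3 le ->
  (forall j, j < n -> [/\ incomp le b (u j), le (w j) b, incomp le (w j) (u j),
                          le (w j) (v j) & le (u j) (v j)]) ->
  (forall i j, i < j -> j < n -> le (v i) (u j)) ->
  embeds (@srel (restr P1 n.*2)) le.
Proof.
move=> leP w2 H vu.
have [] := @half_right T (dual le) (dual_poset leP) _ n b
  (fun j => v (n - j.+1)) (fun j => u (n - j.+1)) (fun j => w (n - j.+1)).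
- by move=> x y z; rewrite !(incomp_dual le); apply: w2.
- move=> j jn; have [|? ? ? ? ?] := H (n - j.+1); first by lia.
  by split; rewrite ?(incomp_dual le).
- by move=> i j ij jn; apply: vu; lia.
move=> f [fI fM]; exists (f \o @rev_ord _); split.
  exact: inj_comp fI rev_ord_inj.
move=> i j; rewrite -[le _ _]/(dual le _ _) /= fM /= !P1E.
by have := ltn_ord i; have := ltn_ord j; lia.
Qed.

Lemma induced_path_embeds (T : finType) (le : rel T) n (p : nat -> T) :
  is_poset le -> 3 < n ->
  (forall i j, i < n -> j < n -> incomp le (p i) (p j) = path_inf i j) ->
  embeds (@srel (restr path_order n)) le.
Proof.
move=> leP n4 pP; case: (boolP ((2 < n) ==> le (p 0) (p 2))) => [/implyP p02|].
  by apply: (path_embeds leP n4 pP); apply: path_orient_all.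
rewrite negb_imply => /andP[n3 n02].
have /orP[p02|p20] : le (p 0) (p 2) || le (p 2) (p 0) by rewrite -incompN pP /path_inf /=; lia.
  by rewrite p02 in n02.
have pP' i j : i < n -> j < n -> incomp (dual le) (p i) (p j) = path_inf i j.
  by rewrite (incomp_dual le); apply: pP.
have ple := path_orient_all (dual_poset leP) pP' (fun _ => p20).
(* The path is read backwards to undo the passage to the dual. *)
apply: (@path_embeds T le leP n (fun i => p (n - i.+1))) => // i j ij jn.
  by rewrite pP /path_inf /=; lia.
by apply: ple; lia.
Qed.

(** * Large prime structures *)

Section Balls.

Variables (T : finType) (adj : rel T).
Hypotheses (adj_sym : symmetric adj) (adj_irr : irreflexive adj).

Definition ball (x : T) (r : nat) : {set T} :=
  iter r (fun B : {set T} => \bigcup_(z in B) (z |: [set y | adj z y])) [set x].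

Lemma card_ball x d r :
  (forall z, #|[set y | adj z y]| <= d) -> #|ball x r| <= d.+1 ^ r.
Proof.
move=> deg; elim: r => [|r IH]; first by rewrite cards1.
rewrite /ball iterS -/(ball x r) expnSr; apply: leq_trans (leq_mul IH (leqnn _)).
rewrite -sum_nat_const.
apply: (big_ind2 (fun (A : {set T}) m => #|A| <= m)) => [|A m B k Am Bk|z _].
- by rewrite cards0.
- by apply: leq_trans (leq_card_setU _ _) _; apply: leq_add.
- by rewrite cardsU1; have := deg z; case: (z \notin _) => /=; lia.
Qed.

Lemma ball_adj x r y z : y \in ball x r -> adj y z -> z \in ball x r.+1.
Proof. by move=> yB yz; apply/bigcupP; exists y => //; rewrite !inE yz orbT. Qed.

(** The vertices are found backwards from [v], each one step closer to [x]. The third clause makes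
    distances exact: a chord would bring a vertex into too small a ball. *)
Lemma geodesic x r v :
  v \in ball x r -> (forall i, i < r -> v \notin ball x i) ->
  exists p : nat -> T, [/\ p r = v,
    forall i, i <= r -> p i \in ball x i,
    forall i j, i < j -> j <= r -> p j \notin ball x i &
    forall i, i < r -> adj (p i) (p i.+1)].
Proof.
elim: r v => [|r IH] v vB vN.
  by exists (fun _ => v); split=> // [[|i]|[|i] [|j]].
have /bigcupP[z zB] := vB; rewrite !inE => /orP[/eqP vz|zv].
  by have := vN r (ltnSn r); rewrite vz zB.
have [|p [pr pB pN pA]] := IH z zB.
  by move=> i ir; apply: contra (vN i.+1 ir) => /ball_adj; apply.
exists (fun i => if i == r.+1 then v else p i); split.
- by rewrite eqxx.
- move=> i; case: eqP => [->//|ne] ir; apply: pB; lia.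
- move=> i j ij jr; case: eqP => [e|ne]; first by apply: vN; lia.
  by apply: pN => //; lia.
- move=> i ir; case: eqP => [|_]; first by lia.
  case: eqP => [[->]|ne]; first by rewrite pr.
  by apply: pA; lia.
Qed.

Lemma geodesic_induced x r v :
  v \in ball x r -> (forall i, i < r -> v \notin ball x i) ->
  exists p : nat -> T, forall i j, i < r.+1 -> j < r.+1 ->
    adj (p i) (p j) = path_inf i j.
Proof.
move=> vB vN; have [p [_ pB pN pA]] := geodesic vB vN; exists p.
have lt i j : i < j -> j <= r -> adj (p i) (p j) = (j == i.+1).
  move=> ij jr; case: eqP => [e|ne]; first by rewrite e; apply: pA; lia.
  apply: contraTF isT => /(ball_adj (pB i _)) pj.
  by have := pN i.+1 j; rewrite pj; lia.
move=> i j ir jr; rewrite /path_inf /=; case: (ltngtP i j) => ij.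
- by rewrite lt //; lia.
- by rewrite adj_sym lt //; lia.
- by rewrite ij adj_irr; lia.
Qed.

(** Closed sets are used instead of paths because a closed set is directly a module of a graph. *)
Definition adj_connected := forall A : {set T},
  A != set0 -> (forall x y, x \in A -> adj x y -> y \in A) -> A = setT.

(** The ball of radius [n] is too small to be everything, so by connectedness some vertex lies at
    distance exactly [n.+1] from its centre. *)
Lemma large_connected d n :
  adj_connected -> (forall z, #|[set y | adj z y]| <= d) -> d.+1 ^ n < #|T| ->
  exists p : nat -> T, forall i j, i < n -> j < n ->
    adj (p i) (p j) = path_inf i j.
Proof.
move=> conn deg big.
have [x _] : exists x : T, x \in T by apply/card_gt0P; apply: leq_ltn_trans big.
have ballS i : ball x i \subset ball x i.+1.
  by apply/subsetP => y yB; apply/bigcupP; exists y => //; rewrite !inE eqxx.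
have ball_leq i j : i <= j -> ball x i \subset ball x j.
  move=> /subnKC <-; elim: (j - i) => [|k IH]; first by rewrite addn0.
  by rewrite addnS; apply: subset_trans (ballS _).
have nT : ball x n <> setT.
  by move=> e; have := card_ball x n deg; rewrite e cardsT leqNgt big.
have [z [v [zB zv vB]]] :
    exists z v, [/\ z \in ball x n, adj z v & v \notin ball x n].
  apply: NNPP => none; apply: nT; apply: conn => [|y z yB yz].
    apply/set0Pn; exists x; apply: (subsetP (ball_leq 0 n _)) => //.
    by rewrite inE.
  by apply/negPn/negP => zB; apply: none; exists y, z.
have [|p pP] := geodesic_induced (ball_adj zB zv).
  move=> i i_n; apply: contra vB; apply/subsetP; exact: ball_leq.
by exists p => i j i_n jn; apply: pP; lia.
Qed.

End Balls.

(** * Vertices of large degree, and the dichotomy *)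

Definition twin_free (T : Type) (le : rel T) := forall u v, le u v ->
  (forall y, incomp le u y = incomp le v y) -> u = v.

Lemma half_from_filter (a : pred nat) k n : n <= count a (iota 0 k) ->
  exists idx : nat -> nat, (forall j, j < n -> a (idx j) /\ idx j < k) /\
    (forall i j, i < j -> j < n -> idx i < idx j).
Proof.
rewrite -size_filter => sz; exists (nth 0 (filter a (iota 0 k))); split.
  move=> j jn; have := mem_nth 0 (leq_trans jn sz).
  by rewrite mem_filter mem_iota => /andP[-> /=].
have srt : sorted ltn (filter a (iota 0 k)).
  by apply: sorted_filter (iota_ltn_sorted _ _); apply: ltn_trans.
move=> i j ij jn; apply: (sorted_ltn_nth ltn_trans 0 srt) => //.
  by rewrite inE; lia.
by rewrite inE; lia.
Qed.

Lemma large_degree_half (T : finType) (le : rel T) n b :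
  is_poset le -> no_antichain3 le -> twin_free le ->
  n.*2.+1 < #|[set y | incomp le b y]| ->
  embeds (@srel (restr P1 n.*2)) le.
Proof.
move=> leP w2 tf deg; have [leR leA leT] := leP.
pose s := sort le (enum [set y | incomp le b y]).
have sz : size s = #|[set y | incomp le b y]| by rewrite size_sort cardE.
have s_uniq : uniq s by rewrite sort_uniq enum_uniq.
pose a i := nth b s i.
have ab i : i < size s -> incomp le b (a i).
  by move/(mem_nth b); rewrite mem_sort mem_enum inE.
have srt : sorted le s.
  apply: (@sort_sorted_in _ [set y | incomp le b y]) => [x y|].
    rewrite !inE => bx b_y; apply: contraT; rewrite negb_or => xy; exfalso.
    by apply: (w2 x y b); rewrite // incomp_sym.
  by apply/allP => y; rewrite mem_enum.
have aleq i j : i <= j -> j < size s -> le (a i) (a j).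
  by move=> ij js; apply: (sorted_leq_nth leT leR b srt) => //; rewrite inE; lia.
(* An element telling consecutive neighbours apart is comparable to [b] by the width. If
   incomparable to the larger neighbour it lies above the smaller one, hence above [b]; the other
   case is the mirror image [L]. *)
pose R i := [exists w, [&& le b w, incomp le w (a i.+1) & le (a i) w]].
pose L i := [exists w, [&& le w b, incomp le w (a i) & le w (a i.+1)]].
have RL i : i.+1 < size s -> R i || L i.
  move=> is_.
  have aii : le (a i) (a i.+1) by apply: aleq.
  have nb w j : j < size s -> incomp le w (a j) -> le b w \/ le w b.
    move=> js wj; apply/orP; rewrite -incompN; apply/negP => bw.
    by apply: (w2 b w (a j)) => //; apply: ab.
  have [w ww] : exists w, incomp le (a i) w != incomp le (a i.+1) w.
    apply: NNPP => none.
    have /eqP : a i = a i.+1.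
      apply: tf => // y; apply/eqP/negPn/negP => ne; apply: none; by exists y.
    by rewrite nth_uniq ?(ltnW is_) // => /eqP; lia.
  have [i1|i1] := boolP (incomp le (a i.+1) w); have [i0|i0] := boolP (incomp le (a i) w);
    rewrite ?i1 ?i0 ?(negbTE i1) ?(negbTE i0) // in ww.
    apply/orP; left; apply/existsP; exists w.
    rewrite incomp_sym i1; have [lw|lw] := orP (etrans (esym (incompN _ _ _)) i0); last first.
      by case/andP: i1 => _ /negP[]; apply: leT lw aii.
    have [|bw|wb] := nb w i.+1 is_; first by rewrite incomp_sym.
      by rewrite bw lw.
    have /andP[_ /negP[]] : incomp le b (a i) by apply: ab; lia.
    exact: leT lw wb.
  apply/orP; right; apply/existsP; exists w.
  rewrite incomp_sym i0; have [lw|lw] := orP (etrans (esym (incompN _ _ _)) i1).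
    by case/andP: i0 => /negP[]; apply: leT aii lw.
  have [||bw|wb] := nb w i; [by lia|by rewrite incomp_sym| |by rewrite wb lw].
  by have /andP[/negP nba _] := ab i.+1 is_; case: nba; apply: leT bw lw.
(* Each of the [n.*2] consecutive pairs satisfies [R] or [L], so one of them holds at least [n]
   times. *)
have cnt : n <= count R (iota 0 n.*2) \/ n <= count L (iota 0 n.*2).
  apply/orP; have := count_predUI R L (iota 0 n.*2).
  have -> : count (predU R L) (iota 0 n.*2) = n.*2.
    rewrite -[RHS](size_iota 0); apply/eqP; rewrite -all_count; apply/allP => i.
    by rewrite mem_iota => i2; apply: RL; lia.
  lia.
case: cnt => /half_from_filter[idx [idxP idx_lt]].
  (* For [j < n] the pick succeeds and the default [b] is not reached. *)
  pose w j := odflt b [pick w | [&& le b w, incomp le w (a (idx j).+1) & le (a (idx j)) w]].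
  apply: (@half_right _ le leP w2 n b (a \o idx) (fun j => a (idx j).+1) w).
    move=> j jn; have [/existsP[w0 w0P] jk] := idxP j jn.
    have := ab (idx j).+1; rewrite /w /=; case: pickP => [w1 /and3P[? ? ?]|none].
      by move=> H; split=> //; [apply: H|apply: aleq]; lia.
    by have := none w0; rewrite w0P.
  move=> i j ij jn /=; have [_ jk] := idxP j jn.
  by have := idx_lt i j ij jn => lt; apply: aleq; lia.
pose w j := odflt b [pick w | [&& le w b, incomp le w (a (idx j)) & le w (a (idx j).+1)]].
apply: (@half_left _ le n b (a \o idx) (fun j => a (idx j).+1) w leP w2).
  move=> j jn; have [/existsP[w0 w0P] jk] := idxP j jn.
  have := ab (idx j); rewrite /w /=; case: pickP => [w1 /and3P[? ? ?]|none].
    by move=> H; split=> //; [apply: H|apply: aleq]; lia.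
  by have := none w0; rewrite w0P.
move=> i j ij jn /=; have [_ jk] := idxP j jn.
by have := idx_lt i j ij jn => lt; apply: aleq; lia.
Qed.

(** The base is [d.+1] for the degree bound [d = n.*2.+1] of [large_degree_half]; the exponent
    [n + 4] makes the path longer than 3 for every [n]. *)
Lemma unavoidable_width2 n (T : finType) (le : rel T) :
  is_poset le -> no_antichain3 le -> adj_connected (incomp le) -> twin_free le ->
  n.*2.+2 ^ (n + 4) < #|T| ->
  embeds (@srel (restr P1 n)) le \/ embeds (@srel (restr path_order n)) le.
Proof.
move=> leP w2 conn tf big.
have [leR _ _] := leP.
case: (boolP [exists b, n.*2.+1 < #|[set y | incomp le b y]|]).
  move=> /existsP[b /(large_degree_half leP w2 tf) emb]; left.
  by apply: embeds_trans emb; apply: embeds_restr_leq; lia.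
rewrite negb_exists => /forallP deg; right.
have [||p pP] := large_connected (incomp_sym le) _ conn _ big.
- by move=> x; rewrite /incomp /= leR.
- by move=> z; rewrite leqNgt.
have emb : embeds (@srel (restr path_order (n + 4))) le.
  by apply: induced_path_embeds leP _ pP; lia.
by apply: embeds_trans emb; apply: embeds_restr_leq; lia.
Qed.

(** * Connectedness and absence of twins in primes *)

Lemma prime_proper_module_card1 (S : finStruct) (A : {set S}) x y :
  prime_struct S -> is_module A -> x \in A -> y \notin A -> #|A| = 1.
Proof.
move=> pS /pS [->|[z ->]|->]; first by rewrite inE.
  by rewrite cards1.
by rewrite !inE.
Qed.

Lemma neq_setT (T : finType) (A : {set T}) : A != setT -> exists x, x \notin A.
Proof.
move=> AnT; apply/existsP; rewrite -negb_forall; apply: contra AnT => /forallP AT.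
by apply/eqP/setP => x; rewrite inE AT.
Qed.

(** Distinct components of the incomparability graph lie one above the other, so the elements below
    some member of a component form the lower part of a split. *)
Lemma poset_connected (S : finStruct) :
  is_poset (@srel S) -> prime_struct S -> 2 < #|S| ->
  adj_connected (incomp (@srel S)).
Proof.
move=> [leR leA leT] pS S3 A An0 Aclosed; apply/eqP; apply: contraTT S3 => AnT.
(* A split of the poset into a lower and an upper part gives two modules. *)
have cut (X : {set S}) x y : x \in X -> y \notin X ->
    (forall u v, u \in X -> v \notin X -> srel u v) -> ~~ (2 < #|S|).
  move=> xX yX low.
  have up u v : u \in X -> v \notin X -> srel v u = false.
    move=> uX vX; apply: contraNF (vX) => vu.
    by rewrite (_ : v = u) //; apply: leA; rewrite vu low.
  have X1 : #|X| = 1.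
    apply: (@prime_proper_module_card1 S X x y) => // v u w vX uX wX.
    by rewrite !(up _ v) // !low.
  have C1 : #|~: X| = 1.
    apply: (@prime_proper_module_card1 S (~: X) y x) => //; rewrite ?inE ?negbK //.
    move=> v u w; rewrite !inE negbK => vX uX wX.
    by rewrite !(up v) // !low.
  by rewrite -(cardsC X) X1 C1.
have {An0} [a aA] := set0Pn _ An0.
have [b bA] := neq_setT AnT.
have cmp x y : x \in A -> y \notin A -> srel x y || srel y x.
  move=> xA yA; apply: contraR yA; rewrite negb_or => xy.
  exact: Aclosed xA xy.
(* Passing to the complement of [A] exchanges [a] and [b]. *)
wlog ab : A a b aA bA Aclosed cmp {AnT} / srel a b.
  move=> H; case/orP: (cmp a b aA bA) => [|ba]; first exact: H aA bA Aclosed cmp.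
  apply: (H (~: A) b a) => //; rewrite ?inE ?negbK //.
    move=> x y; rewrite !inE => xA xy; apply: contra xA => yA.
    by apply: Aclosed yA _; rewrite incomp_sym.
  by move=> x y; rewrite !inE negbK orbC => xA yA; apply: cmp.
pose C := [set c | connect (incomp (@srel S)) a c].
have CA : C \subset A.
  apply/subsetP => c; rewrite inE => /connectP[p]; elim: p a aA {ab C} => [|z p IH] x xA /=.
    by move=> _ ->.
  by move=> /andP[xz]; apply: IH; apply: Aclosed xz.
(* Along a path of incomparabilities [z] cannot change sides: [x] below [z] below [y] would make [x]
   and [y] comparable. *)
have above z : z \notin C -> srel a z -> forall c, c \in C -> srel c z.
  move=> zC az c; rewrite inE => /connectP[p pp ->].
  suff H x : connect (incomp (@srel S)) a x -> srel x z ->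
      path (incomp (@srel S)) x p -> srel (last x p) z by apply: H.
  elim: p x {pp} => [|y p IH] x ax xz //= /andP[xy pp].
  have ay : connect (incomp (@srel S)) a y.
    by apply: connect_trans ax _; apply: connect1.
  apply: IH => //.
  have : srel y z || srel z y.
    rewrite -incompN; apply: contra zC => yz; rewrite inE; apply: connect_trans ay _.
    exact: connect1.
  case/orP => // zy; case/andP: xy => /negP[]; exact: leT zy.
have aC : a \in C by rewrite inE.
have bC : b \notin C by apply: contra bA; apply/subsetP.
apply: (cut [set y | [exists c in C, srel y c]] a b).
- by rewrite inE; apply/existsP; exists a; rewrite aC leR.
- rewrite inE; apply/existsP => -[c /andP[cC bc]].
  have cb := above b bC ab c cC.
  by move: bA; rewrite (leA b c) ?bc // (subsetP CA).
move=> u v; rewrite !inE => /existsP[c /andP[cC uc]]; rewrite negb_exists => /forallP vX.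
have vC : v \notin C by have := vX v; rewrite leR andbT.
have av : srel a v.
  have : srel a v || srel v a.
    rewrite -incompN; apply: contra vC => av; rewrite inE; exact: connect1.
  by case/orP => // va; have := vX a; rewrite aC va.
exact: leT uc (above v vC av c cC).
Qed.

(* Two elements with the same incomparabilities bound an interval which is a
   module. *)
Lemma poset_twin_free (S : finStruct) :
  is_poset (@srel S) -> prime_struct S -> 2 < #|S| -> twin_free (@srel S).
Proof.
move=> leP pS S3 u v uv tw; have conn := poset_connected leP pS S3.
have [leR leA leT] := leP; apply/eqP/contraT => nuv.
pose I := [set x | srel u x && srel x v].
have modI : is_module I.
  suff H y x : y \notin I -> x \in I -> srel y x = srel y u /\ srel x y = srel u y.
    by move=> y x z yI xI zI; have [-> ->] := H y x yI xI; have [-> ->] := H y z yI zI.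
  rewrite !inE negb_and => yI /andP[ux xv]; split.
    apply/idP/idP => [yx|yu]; last exact: leT yu ux.
    case: (boolP (srel y u)) => // nyu.
    have nuy : ~~ srel u y by move: yI; rewrite (leT _ _ _ yx xv) orbF.
    have := tw y; rewrite /incomp /= nyu nuy /= (leT _ _ _ yx xv) andbF => H. by [].
  apply/idP/idP => [xy|uy]; first exact: leT ux xy.
  move: yI; rewrite uy /= => nyv; have := tw y; rewrite /incomp /= uy nyv andbT /=.
  by move/esym/negbFE => vy; apply: leT xv vy.
have uI : u \in I by rewrite inE leR uv.
have vI : v \in I by rewrite inE leR uv.
have IT : I = setT.
  case: (pS I modI) => [e|[z e]|//]; first by rewrite e inE in uI.
  by move: uI vI nuv; rewrite e !inE => /eqP-> /eqP->; rewrite eqxx.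
(* Now [u] is the least element, hence isolated in the connected incomparability graph. *)
have : [set u] = setT.
  apply: conn => [|x y]; first by apply/set0Pn; exists u; rewrite inE.
  rewrite inE => /eqP-> /andP[/negP nuy _]; case: nuy.
  by have : y \in I; [rewrite IT inE | rewrite inE => /andP[]].
by move/setP/(_ v); rewrite !inE eq_sym (negbTE nuv).
Qed.

Lemma graph_connected (S : finStruct) :
  is_graph (@srel S) -> prime_struct S -> 2 < #|S| -> adj_connected (@srel S).
Proof.
move=> [adjS adjI] pS S3 A An0 Aclosed; apply/eqP; apply: contraTT S3 => AnT.
have [a aA] := set0Pn _ An0.
have [b bA] := neq_setT AnT.
have no x y : x \in A -> y \notin A -> srel x y = false /\ srel y x = false.
  move=> xA yA; rewrite [srel y x]adjS; suff -> : srel x y = false by [].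
  by apply: contraNF yA; apply: Aclosed.
have A1 : #|A| = 1.
  apply: (@prime_proper_module_card1 S A a b) => // v x y vA xA yA.
  by have [-> ->] := no x v xA vA; have [-> ->] := no y v yA vA.
have C1 : #|~: A| = 1.
  apply: (@prime_proper_module_card1 S (~: A) b a) => //; rewrite ?inE ?negbK //.
  move=> v x y; rewrite !inE negbK => vA xA yA.
  by have [-> ->] := no v x vA xA; have [-> ->] := no v y vA yA.
by rewrite -(cardsC A) A1 C1.
Qed.

(** Twins form a module with two elements. *)
Lemma graph_twin_free (S : finStruct) (le : rel S) :
  is_graph (@srel S) -> @srel S =2 incomp le -> prime_struct S -> 2 < #|S| ->
  twin_free le.
Proof.
move=> [adjS adjI] sE pS S3 u v uv tw; apply/eqP/contraT => nuv.
have modA : is_module [set u; v].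
  have tw' y x : x \in [set u; v] -> srel x y = srel u y.
    by rewrite !inE => /orP[] /eqP-> //; rewrite !sE tw.
  move=> y x z _ xA zA; rewrite ![srel y _]adjS.
  by rewrite (tw' y x xA) (tw' y z zA).
have c2 : #|[set u; v]| = 2 by rewrite cards2 nuv.
case: (pS _ modA) c2 => [->|[z ->]|->]; rewrite ?cards0 ?cards1 ?cardsT // => e.
by rewrite e in S3.
Qed.

(** * Application to the two classes *)

Lemma unavoidable_posets :
  unavoidable (fun S => is_poset (@srel S) /\ width (@srel S) <= 2) P1 path_order.
Proof.
move=> n; exists (n.*2.+2 ^ (n + 4) + 2) => S [leP w2] pS big.
have S3 : 2 < #|S| by lia.
have [leR _ _] := leP.
apply: unavoidable_width2 => //; last by lia.
- exact: width2_no_antichain3.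
- exact: poset_connected.
- exact: poset_twin_free.
Qed.

(** Primality is that of the graph, but the search takes place in the order [le]; the embedding
    found there is then carried to incomparability graphs. *)
Lemma unavoidable_graphs :
  unavoidable (fun S => is_graph (@srel S) /\ incomp_graph_of_width_le2 S)
    (incomp P1) (incomp path_order).
Proof.
move=> n; exists (n.*2.+2 ^ (n + 4) + 2) => S [gS [le [leP w2 sE]]] pS big.
have S3 : 2 < #|S| by lia.
have [leR _ _] := leP.
have sE' : incomp le =2 @srel S by move=> x y; rewrite sE.
have [||||emb|emb] := @unavoidable_width2 n S le leP.
- exact: width2_no_antichain3.
- move=> A An0 Acl; apply: (graph_connected gS pS S3 An0) => x y xA.
  by rewrite sE; apply: Acl.
- exact: (graph_twin_free gS sE).
- by lia.
- by left; apply: eq_embeds_r sE' _; apply: embeds_incomp emb.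
- by right; apply: eq_embeds_r sE' _; apply: embeds_incomp emb.
Qed.

Theorem mainTheorem7 :
  (forall C : structClass,
     hereditary C ->
     (forall S : finStruct, C S ->
        is_poset (@srel S) /\ width (@srel S) <= 2) ->
     (minimal_prime C <-> same_class C (age P1) \/ same_class C (age P2)))
  /\
  (forall C : structClass,
     hereditary C ->
     (forall S : finStruct, C S ->
        is_graph (@srel S) /\ incomp_graph_of_width_le2 S) ->
     (minimal_prime C <->
        same_class C (age half_graph) \/ same_class C (age path_inf))).
Proof.
have same_trans (C D E : structClass) : same_class D E -> same_class C D <-> same_class C E.
  by move=> DE; split=> CD S; [rewrite CD|rewrite CD DE].
have [P1p Qp] := (many_primes_P1, many_primes_path_order).
have [P1n Qn] := (P1_not_in_path_order, path_order_not_in_P1).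
split=> C herC CP.
  rewrite (same_trans C _ _ age_P2); apply: minimal_prime_iff CP => //.
  - exact: unavoidable_posets.
  - exact: many_primes_incomp.
  - exact: many_primes_incomp.
  - exact: not_in_age_incomp.
  - exact: not_in_age_incomp.
rewrite (same_trans C _ _ age_half_graph) (same_trans C _ _ age_path_inf).
by apply: minimal_prime_iff CP => //; apply: unavoidable_graphs.
Qed.
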